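(* Let $Q=\mathbb{R}^n$, let $M$ and $K$ be symmetric positive definite real $n\times n$ matrices such that $K$ and $M^{-1}$ commute, and let $b>0$. Consider the Lagrangian $L:TQ\to\mathbb{R}$, $L(q,\dot q)=\frac12\dot q^{T}M\dot q-\frac12 q^{T}Kq$, subject to the dissipative force $F(q,\dot q)=-b\,\dot q^{i}dq^{i}$ (sum over $i$), and let $\Gamma$ be the corresponding forced mechanical vector field on $TQ$. Put $V(q)=\frac12 q^TKq$, and let $\bar q\in Q$ be an isolated zero of $\operatorname{grad}V$ which is also an equilibrium point of the equations of motion. Then there exist an open neighbourhood $\mathcal{U}$ of $0_{\bar q}\in TQ$ and a parameter $\varepsilon$ such that $(TQ,\Gamma,\mathbb{G}_\varepsilon,\mathcal{U})$ is a contracting system, where $\mathbb{G}_\varepsilon$ is the mechanical contraction metric associated with $L$ and $F$ and parameter $\varepsilon$.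
   Context: The forced equations of motion are $\frac{d}{dt}\frac{\partial L}{\partial\dot q^i}-\frac{\partial L}{\partial q^i}=F^i$ with $F^i=-b\dot q^i$, that is, $\ddot q=M^{-1}(-Kq-b\dot q)$. The forced mechanical vector field is the second-order vector field on $TQ$ whose integral curves are the solutions, $\Gamma(q,\dot q)=(\dot q,\,-M^{-1}(Kq+b\dot q))$. The point $0_{\bar q}$ is the zero vector in $T_{\bar q}Q$, i.e. $(q,\dot q)=(\bar q,0)$. The mechanical contraction metric associated with $L$ and $F$ and parameter $\varepsilon$ is the Riemannian metric on $TQ\cong\mathbb{R}^{2n}$ given, in the coordinates $(q,\dot q)$, by the constant block matrix $$\mathbb{G}_\varepsilon=\begin{bmatrix}K & b\varepsilon I_n\\ b\varepsilon I_n & M\end{bmatrix}.$$ A contracting system is a tuple $(N,X,g,\mathcal{U})$, where $N$ is a smooth manifold, $X$ is a smooth vector field on $N$, $g$ is a Riemannian metric on $N$ (in particular positive definite) and $\mathcal{U}\subseteq N$ is open, such that there exists $\lambda>0$ with $(\mathcal{L}_X g)(v_x,v_x)\leq-2\lambda\,g(v_x,v_x)$ for all $x\in\mathcal{U}$ and $v_x\in T_xN$. Here $\mathcal{L}_X g$ is the Lie derivative of $g$ along $X$. *)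

(* Defs.v *)
From HB Require Import structures.
From mathcomp Require Import all_boot all_order all_algebra.
From mathcomp Require Import all_classical all_reals all_analysis.
From mathcomp Require Import ring lra.

Set Implicit Arguments.
Unset Strict Implicit.
Unset Printing Implicit Defensive.

Import Order.TTheory GRing.Theory Num.Theory.
Import numFieldNormedType.Exports.

Local Open Scope classical_set_scope.
Local Open Scope ring_scope.

(* The configuration space is 'cV[R]_n; its tangent bundle is 'cV[R]_(n + n), in which
   (q, v) is encoded as col_mx q v. *)

Section Geometry.
Context {R : realType}.

Definition bform N (G : 'M[R]_N) (u v : 'cV[R]_N) : R := (u^T *m G *m v) 0 0.

Definition posdef N (G : 'M[R]_N) : Prop :=
  forall v : 'cV[R]_N, v != 0 -> 0 < bform G v v.

(* C^oo: every iterated directional derivative of f is Frechet differentiable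
   everywhere (the empty list of directions gives f itself). *)
Definition smooth (V W : normedModType R) (f : V -> W) : Prop :=
  forall (vs : seq V) (x : V),
    differentiable (foldr (fun v (g : V -> W) => 'D_v g) f vs) x.

(* A metric on 'cV[R]_N is given by its field of Gram matrices in the standard
   coordinates. *)
Definition riemannian_metric N (g : 'cV[R]_N -> 'M[R]_N) : Prop :=
  [/\ smooth g, forall x, (g x)^T = g x & forall x, posdef (g x)].

(* Coordinate expression of the Lie derivative of a covariant 2-tensor:
   (L_X g)_ij = X^k d_k g_ij + g_kj d_i X^k + g_ik d_j X^k. *)
Definition lie_derivative N (X : 'cV[R]_N -> 'cV[R]_N)
    (g : 'cV[R]_N -> 'M[R]_N) (x u v : 'cV[R]_N) : R :=
  'D_(X x) (fun y => bform (g y) u v) x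
  + bform (g x) ('D_u X x) v + bform (g x) u ('D_v X x).

Definition contracting_system N (X : 'cV[R]_N -> 'cV[R]_N)
    (g : 'cV[R]_N -> 'M[R]_N) (U : set 'cV[R]_N) : Prop :=
  [/\ smooth X, riemannian_metric g, open U &
      exists2 lambda : R, 0 < lambda &
        forall x v, U x ->
          lie_derivative X g x v v <= - 2 * lambda * bform (g x) v v].

Definition gradient n (V : 'cV[R]_n -> R) (q : 'cV[R]_n) : 'cV[R]_n :=
  \col_i 'D_(delta_mx i 0) V q.

Definition isolated_zero n (Y : 'cV[R]_n -> 'cV[R]_n) (q : 'cV[R]_n) : Prop :=
  Y q = 0 /\ \forall p \near q^', Y p <> 0.

End Geometry.

Section Mechanics.
Context {R : realType}.

Definition dL_dq n (L : 'cV[R]_(n + n) -> R) (i : 'I_n) (x : 'cV[R]_(n + n)) : R :=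
  'D_(col_mx (delta_mx i 0) 0) L x.

Definition dL_dv n (L : 'cV[R]_(n + n) -> R) (i : 'I_n) (x : 'cV[R]_(n + n)) : R :=
  'D_(col_mx 0 (delta_mx i 0)) L x.

Definition velocity_lift n (q : R -> 'cV[R]_n) (t : R) : 'cV[R]_(n + n) :=
  col_mx (q t) (derive1 q t).

(* The covector field F is given by its components on dq^1, ..., dq^n. The
   derivability clauses are needed because derive1 is a total operator. *)
Definition forced_solution n (L : 'cV[R]_(n + n) -> R)
    (F : 'cV[R]_(n + n) -> 'cV[R]_n) (J : set R) (q : R -> 'cV[R]_n) : Prop :=
  forall t, J t ->
    [/\ derivable q t 1, derivable (derive1 q) t 1 &
        forall i, let p s := dL_dv L i (velocity_lift q s) in
          derivable p t 1 /\
          derive1 p t - dL_dq L i (velocity_lift q t) = F (velocity_lift q t) i 0].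

Definition equilibrium n (L : 'cV[R]_(n + n) -> R)
    (F : 'cV[R]_(n + n) -> 'cV[R]_n) (q : 'cV[R]_n) : Prop :=
  forced_solution L F setT (cst q).

Definition integral_curve N (X : 'cV[R]_N -> 'cV[R]_N) (J : set R)
    (c : R -> 'cV[R]_N) : Prop :=
  forall t, J t -> is_derive t 1 c (X (c t)).

Definition second_order n (X : 'cV[R]_(n + n) -> 'cV[R]_(n + n)) : Prop :=
  forall x, usubmx (X x) = dsubmx x.

Definition forced_mechanical_field n (L : 'cV[R]_(n + n) -> R)
    (F : 'cV[R]_(n + n) -> 'cV[R]_n)
    (X : 'cV[R]_(n + n) -> 'cV[R]_(n + n)) : Prop :=
  [/\ smooth X, second_order X &
      forall (J : set R) (c : R -> 'cV[R]_(n + n)), open J -> is_interval J ->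
        (integral_curve X J c <->
         exists2 q : R -> 'cV[R]_n,
           forced_solution L F J q & forall t, J t -> c t = velocity_lift q t)].

Definition potential n (K : 'M[R]_n) (q : 'cV[R]_n) : R := 2^-1 * bform K q q.

Definition lagrangian n (M K : 'M[R]_n) (x : 'cV[R]_(n + n)) : R :=
  2^-1 * bform M (dsubmx x) (dsubmx x) - 2^-1 * bform K (usubmx x) (usubmx x).

Definition dissipative_force n (b : R) (x : 'cV[R]_(n + n)) : 'cV[R]_n :=
  - b *: dsubmx x.

(* The Gram field is constant, so the base point is ignored. *)
Definition contraction_metric n (M K : 'M[R]_n) (b eps : R)
    (_ : 'cV[R]_(n + n)) : 'M[R]_(n + n) :=
  block_mx K (b * eps)%:M (b * eps)%:M M.

End Mechanics.

Section ForcedFieldFormula.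
Context {R : realType}.

Lemma linear_cV_differentiable N (W : normedModType R) (f : 'cV[R]_N -> W) x :
  linear f -> differentiable f x.
Proof.
move=> lf.
pose F : {linear 'cV[R]_N -> W} := HB.pack f (GRing.isLinear.Build _ _ _ _ f lf).
have -> : f = fun y => \sum_(j < N) (y j 0 *: f (delta_mx j 0)).
  apply/funext => y; rewrite -[f]/(F : _ -> _) {1}[y]matrix_sum_delta linear_sum.
  apply: eq_bigr => j _; rewrite linear_sum big_ord1 linearZ.
  by rewrite -!/(F _).
have -> : (fun y : 'cV[R]_N => \sum_(j < N) (y j 0 *: f (delta_mx j 0)))
  = \sum_(j < N) ((fun y : 'cV[R]_N => y j 0 *: f (delta_mx j 0)) : 'cV[R]_N -> W).
  by apply/funext => y; rewrite fct_sumE.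
apply: differentiable_sum => j.
by apply: differentiableZl; exact: differentiable_coord.
Qed.

Lemma is_derive_linear N (W : normedModType R) (f : 'cV[R]_N -> W) x v :
  linear f -> is_derive x v f (f v).
Proof.
move=> lf; have df := @linear_cV_differentiable N W f x lf.
apply: DeriveDef; first exact: diff_derivable.
have f0 : f 0 = 0.
  have /eqP := lf 1 0 0; rewrite scaler0 addr0 scale1r.
  by rewrite -subr_eq subrr eq_sym => /eqP.
have fZ (h : R) w : f (h *: w) = h *: f w by have := lf h w 0; rewrite f0 !addr0.
rewrite /derive; apply: cvg_lim => //.
apply/cvgrPdist_lt => e e0; near=> h.
have h0 : h != 0 by near: h; exact: nbhs_dnbhs_neq.
by rewrite /= lf addrK scalerA mulVf // scale1r subrr normr0.
Unshelve. all: by end_near. Qed.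

Lemma smooth_linear N (W : normedModType R) (f : 'cV[R]_N -> W) :
  linear f -> smooth f.
Proof.
move=> lf vs x.
pose D := foldr (fun v (g : 'cV[R]_N -> W) => 'D_v g) f; rewrite -/(D vs).
suff [->|[w ->]] : D vs = f \/ exists w, D vs = cst w.
- exact: linear_cV_differentiable.
- exact: differentiable_cst.
elim: vs => [|v vs IH]; [by left|right].
rewrite /D /= -/(D vs); case: IH => [->|[w ->]].
- exists (f v); apply/funext => y; by have [] := is_derive_linear y v lf.
- by exists 0; apply/funext => y; rewrite derive_cst.
Qed.

Lemma bformD N (A : 'M[R]_N) a u v w :
  (bform A (a *: u + v) w = a * bform A u w + bform A v w) *
  (bform A w (a *: u + v) = a * bform A w u + bform A w v).
Proof.
by rewrite /bform linearP /= !mulmxDl !mulmxDr -!scalemxAl -!scalemxAr !mxE.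
Qed.

Lemma is_derive_quad N p (l : 'cV[R]_N -> 'cV[R]_p) (A : 'M[R]_p) x w :
  linear l ->
  is_derive x w (fun y => bform A (l y) (l y))
    (bform A (l w) (l x) + bform A (l x) (l w)).
Proof.
move=> ll.
pose d := bform A (l w) (l x) + bform A (l x) (l w); rewrite -/d.
suff cv : (fun h : R => h^-1 *: (bform A (l (h *: w + x)) (l (h *: w + x))
  - bform A (l x) (l x))) @ 0^' --> d.
  apply: DeriveDef; first by apply/cvg_ex; eexists; exact: cv.
  exact: (cvg_lim _ cv).
have cv2 : (fun h : R => d + h * bform A (l w) (l w)) @ 0^' --> d.
  rewrite -[X in _ --> X]addr0 -[X in _ --> _ + X](mul0r (bform A (l w) (l w))).
  apply: cvgD; first exact: cvg_cst.
  apply: cvgMr_tmp; exact: nbhs_dnbhs.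
apply: cvg_trans cv2; apply: near_eq_cvg; near=> h.
have h0 : h != 0 by near: h; exact: nbhs_dnbhs_neq.
rewrite ll !bformD /d /=; rewrite /GRing.scale /=; field; exact: h0.
Unshelve. all: by end_near. Qed.


Lemma bform_sym N (A : 'M[R]_N) u v : A^T = A -> bform A u v = bform A v u.
Proof.
move=> sA; rewrite /bform.
have -> : v^T *m A *m u = (u^T *m A *m v)^T by rewrite !trmx_mul trmxK sA mulmxA.
by rewrite [RHS]mxE.
Qed.

Lemma bform_delta N (A : 'M[R]_N) i v : bform A (delta_mx i 0) v = (A *m v) i 0.
Proof. by rewrite /bform trmx_delta -mulmxA -rowE mxE. Qed.

Lemma is_derive_lagr n (M K : 'M[R]_n) x w : M^T = M -> K^T = K ->
  is_derive x w (lagrangian M K)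
   (bform M (dsubmx w) (dsubmx x) - bform K (usubmx w) (usubmx x)).
Proof.
move=> sM sK.
have H1 := @is_derive_quad (n+n) n dsubmx M x w (@linearP _ _ _ _ _).
have H2 := @is_derive_quad (n+n) n usubmx K x w (@linearP _ _ _ _ _).
have H := is_deriveB (is_deriveZ 2^-1 H1) (is_deriveZ 2^-1 H2).
apply: is_derive_eq H _.
rewrite (bform_sym (dsubmx x) _ sM) (bform_sym (usubmx x) _ sK) /GRing.scale /=.
by field.
Qed.

Lemma dLdv_lagrangian n (M K : 'M[R]_n) i x : M^T = M -> K^T = K ->
  dL_dv (lagrangian M K) i x = (M *m dsubmx x) i 0.
Proof.
move=> sM sK; rewrite /dL_dv.
have [_ ->] := is_derive_lagr x (col_mx 0 (delta_mx i 0)) sM sK.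
by rewrite col_mxKu col_mxKd bform_delta /bform trmx0 !mul0mx [X in _ - X]mxE subr0.
Qed.

Lemma dLdq_lagrangian n (M K : 'M[R]_n) i x : M^T = M -> K^T = K ->
  dL_dq (lagrangian M K) i x = - (K *m usubmx x) i 0.
Proof.
move=> sM sK; rewrite /dL_dq.
have [_ ->] := is_derive_lagr x (col_mx (delta_mx i 0) 0) sM sK.
by rewrite col_mxKu col_mxKd bform_delta /bform trmx0 !mul0mx [X in X - _]mxE sub0r.
Qed.

Lemma is_derive_mxP m n (c : R -> 'M[R]_(m,n)) (t : R) (d : 'M[R]_(m,n)) :
  is_derive t 1 c d <-> forall i j, is_derive t 1 (fun s => c s i j) (d i j).
Proof.
split=> [[dc <-] i j|H].
  rewrite derive_mx // mxE; apply: DeriveDef => //.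
  by move/derivable_mxP : dc; apply.
have dc : derivable c t 1 by apply/derivable_mxP => i j; have [] := H i j.
apply: DeriveDef => //; apply/matrixP => i j.
by rewrite derive_mx // mxE; have [_ ->] := H i j.
Qed.

Lemma is_derive_mul m n (A : 'M[R]_(m,n)) (c : R -> 'cV[R]_n) (t : R) d :
  is_derive t 1 c d -> is_derive t 1 (fun s => A *m c s) (A *m d).
Proof.
move=> /is_derive_mxP H; apply/is_derive_mxP => i j; rewrite mxE.
have -> : (fun s => (A *m c s) i j) = \sum_(k < n) (A i k \*: (fun s => c s k j)).
  by apply/funext => s; rewrite mxE fct_sumE.
have := @is_derive_sum _ _ _ n (fun k => A i k \*: (fun s => c s k j)) t 1
  (fun k => A i k *: d k j).
apply => k; exact: is_deriveZ.
Qed.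

(* The explicit formula Gamma (q, v) = (v, - M^-1 (K q + b v)). *)
Definition forced_field n (M K : 'M[R]_n) b (x : 'cV[R]_(n+n)) : 'cV[R]_(n+n) :=
  col_mx (dsubmx x) (- (invmx M *m (K *m usubmx x + b *: dsubmx x))).

Lemma usubE n (x : 'cV[R]_(n+n)) i j : x (lshift n i) j = usubmx x i j.
Proof. by rewrite mxE. Qed.
Lemma dsubE n (x : 'cV[R]_(n+n)) i j : x (rshift n i) j = dsubmx x i j.
Proof. by rewrite mxE. Qed.

Lemma forced_fieldP n (M K : 'M[R]_n) b : M^T = M -> K^T = K -> M \in unitmx ->
  forced_mechanical_field (lagrangian M K) (dissipative_force b) (forced_field M K b).
Proof.
move=> sM sK uM; split.
- apply: smooth_linear => a x y.
  rewrite /forced_field scale_col_mx add_col_mx.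
  rewrite !(@linearP _ _ _ _ (@dsubmx _ _ _ _)).
  rewrite !(@linearP _ _ _ _ (@usubmx _ _ _ _)); congr col_mx.
  rewrite scalerN -opprD; congr (- _); rewrite scalemxAr -mulmxDr; congr (_ *m _).
  by rewrite !scalerDr mulmxDr -!scalemxAr !scalerA (mulrC b a) addrACA.
- by move=> x; rewrite /forced_field col_mxKu.
move=> J c oJ iJ; split.
- move=> ic.
  have dc t : J t -> is_derive t 1 (usubmx \o c) (dsubmx (c t)).
    move=> /ic/is_derive_mxP H; apply/is_derive_mxP => i j.
    have := H (lshift n i) j; rewrite /forced_field col_mxEu.
    by under eq_fun do rewrite usubE.
  have dc2 t : J t -> is_derive t 1 (dsubmx \o c) (dsubmx (forced_field M K b (c t))).
    move=> /ic/is_derive_mxP H; apply/is_derive_mxP => i j.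
    have := H (rshift n i) j; rewrite dsubE.
    by under eq_fun do rewrite dsubE.
  have dcE t : J t -> dsubmx (c t) = derive1 (usubmx \o c) t.
    by move=> Jt; rewrite derive1E; have [_ ->] := dc _ Jt.
  have lift t : J t -> c t = velocity_lift (usubmx \o c) t.
    by move=> Jt; rewrite /velocity_lift -dcE //= vsubmxK.
  have nJ t : J t -> \near t, J t by move=> Jt; exact: open_nbhs_nbhs.
  exists (usubmx \o c) => // t Jt; split.
  + by have [] := dc _ Jt.
  + apply: (near_eq_derivable _ (ex_derive (is_derive := dc2 _ Jt))).
    by near=> s; apply: dcE; near: s; exact: nJ.
  + move=> i p.
    have dp : is_derive t 1 p ((M *m dsubmx (forced_field M K b (c t))) i 0).
      have /is_derive_mxP /(_ i 0) := is_derive_mul M (dc2 _ Jt).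
      apply: near_eq_is_derive.
      near=> s; rewrite /p -lift; last by near: s; exact: nJ.
      by rewrite dLdv_lagrangian.
    split; first by have [] := dp.
    rewrite derive1E; have [_ ->] := dp.
    rewrite -lift // dLdq_lagrangian // /forced_field col_mxKd mulmxN mulKVmx //.
    by rewrite /dissipative_force !mxE; ring.
- move=> [q sol clift] t Jt.
  have nJ : \near t, J t by exact: open_nbhs_nbhs.
  have [dq ddq EL] := sol t Jt.
  suff H : is_derive t 1 (velocity_lift q) (forced_field M K b (c t)).
    apply: near_eq_is_derive H.
    by near=> s; apply/esym/clift; near: s.
  have Hq : is_derive t 1 q (derive1 q t) by apply: DeriveDef; rewrite ?derive1E.
  have Hv : is_derive t 1 (derive1 q) (dsubmx (forced_field M K b (c t))).
    apply: DeriveDef => //.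
    apply: (can_inj (mulKmx uM)); apply/matrixP => i j; rewrite ord1.
    have [_] := EL i.
    rewrite dLdq_lagrangian // derive1E.
    have -> : (fun s => dL_dv (lagrangian M K) i (velocity_lift q s)) =
        fun s => (M *m derive1 q s) i 0.
      by apply/funext => s; rewrite dLdv_lagrangian // col_mxKd.
    have /is_derive_mxP /(_ i 0) [_ ->] := is_derive_mul M (derivableP ddq).
    rewrite /forced_field col_mxKd mulmxN mulKVmx // clift // /dissipative_force.
    by rewrite !mxE => H; lra.
  apply/is_derive_mxP => i j; case: (split_ordP i) => k ->.
  - rewrite /forced_field col_mxEu clift // /velocity_lift col_mxKd.
    under eq_fun do rewrite col_mxEu.
    by move/is_derive_mxP : Hq; apply.
  - have /is_derive_mxP /(_ k j) := Hv.
    rewrite /forced_field col_mxKd col_mxEd.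
    by under [in X in _ -> X]eq_fun do rewrite col_mxEd.
Unshelve. all: by end_near. Qed.
End ForcedFieldFormula.

(* Main.v *)
Require Import Defs.
From mathcomp Require Import all_boot all_order all_algebra.
From mathcomp Require Import all_classical all_reals all_analysis.
From mathcomp Require Import ring lra.
Import Order.TTheory GRing.Theory Num.Theory.
Import numFieldNormedType.Exports.
Local Open Scope classical_set_scope.
Local Open Scope ring_scope.

(** The field [Gamma] is linear and [G_eps] is constant, so the Lie derivative
    of the metric is the quadratic form [2 v^T G_eps Gamma v], the same at every
    base point: the contraction inequality holds on the whole tangent bundle or
    nowhere, and the neighbourhood may be taken to be everything.

    [Gamma] is given only through its integral curves. Comparing it with the
    explicit field [(q, v) |-> (v, - M^-1 (K q + b v))] requires a solution curve
    through every point; the power series of the matrix exponential provides one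
    ([is_derive_linear_flow]). That curve is integral for both fields, so its
    velocity at time 0 identifies them ([forced_mechanical_field_unique]).

    Writing [c = b eps], the terms in [K u . w] cancel and
<<
  v^T G Gamma v = - c u^T M^-1 K u - c b u^T M^-1 w - (b - c) |w|^2
>>
    for [v = (u, w)] ([contraction_metric_dissipation]). If [M^-1 K] is coercive,
    Young's inequality absorbs the mixed term half into the first term and half,
    for small [c], into the last one ([forced_field_contracts]).

    Coercivity of [M^-1 K] is where commutation enters: it makes [M^-1 K]
    symmetric, so the minimum of its quadratic form on the unit sphere is an
    eigenvalue [mu], with eigenvector [u] say ([rayleigh_min]). From
    [K u = mu M u] one gets [u^T K u = mu u^T M u], hence [mu > 0]
    ([posdef_invmx_mul]). The same variational principle gives all the other
    upper and lower bounds on quadratic forms. *)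

Set Implicit Arguments.
Unset Strict Implicit.
Unset Printing Implicit Defensive.

(** * Quadratic forms of symmetric matrices *)

Lemma cvg_fin_sum (R : realType) (I : finType) (T : Type) (F : set_system T)
    (f : I -> T -> R) (l : I -> R) : Filter F ->
  (forall i, f i x @[x --> F] --> l i) ->
  \sum_i f i x @[x --> F] --> \sum_i l i.
Proof. by move=> FF fl; apply: cvg_big => //; exact: add_continuous. Qed.

Section BilinearForms.
Context {R : realType}.

Lemma bform_addr N (G : 'M[R]_N) u v w :
  bform G u (v + w) = bform G u v + bform G u w.
Proof. by rewrite /bform mulmxDr mxE. Qed.

Lemma bform_scaler N (G : 'M[R]_N) a u v : bform G u (a *: v) = a * bform G u v.
Proof. by rewrite /bform -scalemxAr mxE. Qed.

Lemma bform_oppr N (G : 'M[R]_N) u v : bform G u (- v) = - bform G u v.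
Proof. by rewrite /bform mulmxN mxE. Qed.

Lemma bform_addl N (G : 'M[R]_N) u v w :
  bform G (u + v) w = bform G u w + bform G v w.
Proof. by rewrite /bform linearD /= !mulmxDl mxE. Qed.

Lemma bform_scalel N (G : 'M[R]_N) a u v : bform G (a *: u) v = a * bform G u v.
Proof. by rewrite /bform linearZ /= -!scalemxAl mxE. Qed.

Lemma bform_mulmxr N (G A : 'M[R]_N) u v : bform G u (A *m v) = bform (G *m A) u v.
Proof. by rewrite /bform !mulmxA. Qed.

Lemma bform_mulmxl N (G A : 'M[R]_N) u v : bform G (A *m u) v = bform (A^T *m G) u v.
Proof. by rewrite /bform trmx_mul !mulmxA. Qed.

Lemma bformDm N (G H : 'M[R]_N) u v : bform (G + H) u v = bform G u v + bform H u v.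
Proof. by rewrite /bform mulmxDr mulmxDl mxE. Qed.

Lemma bformNm N (G : 'M[R]_N) u v : bform (- G) u v = - bform G u v.
Proof. by rewrite /bform mulmxN mulNmx mxE. Qed.

Lemma bform_scalar N a (u v : 'cV[R]_N) : bform a%:M u v = a * bform 1%:M u v.
Proof. by rewrite /bform mul_mx_scalar -scalemxAl mulmx1 mxE. Qed.

Lemma bform1_sum N (u v : 'cV[R]_N) : bform 1%:M u v = \sum_i u i 0 * v i 0.
Proof. by rewrite /bform mulmx1 mxE; apply: eq_bigr => i _; rewrite mxE. Qed.

Lemma bform1_ge0 N (u : 'cV[R]_N) : 0 <= bform 1%:M u u.
Proof. by rewrite bform1_sum sumr_ge0// => i _; rewrite -expr2 sqr_ge0. Qed.

Lemma bform1_eq0 N (u : 'cV[R]_N) : bform 1%:M u u = 0 -> u = 0.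
Proof.
rewrite bform1_sum => /eqP; rewrite psumr_eq0; last first.
  by move=> i _; rewrite -expr2 sqr_ge0.
move=> /allP u0; apply/matrixP => i j; rewrite ord1 mxE.
by have := u0 i (mem_index_enum _); rewrite /= -expr2 sqrf_eq0 => /eqP.
Qed.

Lemma posdef1 N : posdef (1%:M : 'M[R]_N).
Proof.
move=> u u0; rewrite lt_neqAle bform1_ge0 andbT eq_sym.
by apply: contra_neq u0; exact: bform1_eq0.
Qed.

Lemma bform_block n (A B C D : 'M[R]_n) u1 w1 u2 w2 :
  bform (block_mx A B C D) (col_mx u1 w1) (col_mx u2 w2) =
  bform A u1 u2 + bform B u1 w2 + bform C w1 u2 + bform D w1 w2.
Proof.
by rewrite /bform tr_col_mx mul_row_block mul_row_col !mulmxDl !mxE; ring.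
Qed.

(** Young's inequality for the Euclidean product [bform 1%:M], from
    [0 <= |d u + z|^2]. *)
Lemma young N (u z : 'cV[R]_N) d : 0 < d ->
  - (2 * bform 1%:M u z) <= d * bform 1%:M u u + d^-1 * bform 1%:M z z.
Proof.
move=> d0; have := bform1_ge0 (d *: u + z).
rewrite !(bform_addl, bform_addr, bform_scalel, bform_scaler).
rewrite (bform_sym z u (trmx1 _ _)).
set a := bform _ u u; set p := bform _ u z; set q := bform _ z z => H.
rewrite -subr_ge0.
have -> : d * a + d^-1 * q - - (2 * p) = d^-1 * (d * (d * a + p) + (d * p + q)).
  by field; rewrite gt_eqF.
by rewrite mulr_ge0 ?invr_ge0 ?(ltW d0)// (le_trans H)//; lra.
Qed.

(** Along [u - t A u] the form is [- 2 t |A u|^2 + O(t^2)], which would become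
    negative for small [t > 0] if [A u] did not vanish. *)
Lemma semidef_isotropic_ker N (A : 'M[R]_N) u : A^T = A ->
  (forall v, 0 <= bform A v v) -> bform A u u = 0 -> A *m u = 0.
Proof.
move=> sA A0 Au0; apply: bform1_eq0; apply/eqP.
rewrite eq_le bform1_ge0 andbT leNgt; apply/negP.
set r := A *m u; set p := bform 1%:M r r => p0.
have ur : bform A r u = p by rewrite /p {3}/r bform_mulmxr mul1mx.
have := A0 r; set q := bform A r r => q0.
(* With q + 1 in place of q the step is defined even when q = 0. *)
pose t := p / (q + 1).
have t0 : 0 < t by rewrite divr_gt0// ltr_wpDl.
have := A0 (u - t *: r).
rewrite -scaleNr !(bform_addl, bform_addr, bform_scalel, bform_scaler).
rewrite Au0 (bform_sym u r sA) ur -/q.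
set e := (X in 0 <= X); have -> : e = - (t * (2 * p - t * q)) by rewrite /e; ring.
apply/negP; rewrite -ltNge oppr_lt0 mulr_gt0// subr_gt0.
have : t * q <= p.
  rewrite /t mulrAC ler_pdivrMr ?ltr_wpDl// ler_pM2l//; lra.
by lra.
Qed.

(** The minimum [mu] of the form on the compact unit sphere is an eigenvalue:
    [S - mu 1] is positive semidefinite and isotropic at the minimizer, which
    therefore lies in its kernel. The sphere is a set of row vectors, for
    [bounded_closed_compact]; whence the transpositions. *)
Lemma rayleigh_min N (S : 'M[R]_N.+1) : S^T = S ->
  exists (mu : R) (u : 'cV[R]_N.+1), [/\ u != 0, S *m u = mu *: u &
    forall v, mu * bform 1%:M v v <= bform S v v].
Proof.
move=> sS.
have qc (G : 'M[R]_N.+1) :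
    continuous (fun r : 'rV[R]_N.+1 => bform G r^T r^T).
  have -> : (fun r : 'rV[R]_N.+1 => bform G r^T r^T) =
      fun r => \sum_j \sum_i (r 0 i * G i j * r 0 j).
    apply/funext => r; rewrite /bform trmxK mxE; apply: eq_bigr => j _.
    by rewrite !mxE mulr_suml.
  move=> r; apply: (@cvg_fin_sum _ _ _ (nbhs r)) => j.
  apply: (@cvg_fin_sum _ _ _ (nbhs r)) => i.
  by apply: cvgM; [apply: cvgMr_tmp|]; exact: coord_continuous.
pose A := [set r : 'rV[R]_N.+1 | bform 1%:M r^T r^T = 1].
have cA : compact A.
  apply: bounded_closed_compact.
    exists 1; split; first exact: num_real.
    move=> M M1 r Ar /=; rewrite [leLHS]/Num.norm/= mx_normrE; apply/bigmax_leP; split.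
      by rewrite (le_trans _ (ltW M1)).
    move=> [i j] _ /=; rewrite ord1 (le_trans _ (ltW M1))//.
    rewrite -(@ler_pXn2r _ 2)// ?nnegrE// expr1n -normrX ger0_norm ?sqr_ge0//.
    rewrite -Ar bform1_sum (bigD1 j)//= !mxE -expr2 lerDl sumr_ge0// => k _.
    by rewrite -expr2 sqr_ge0.
  apply: (@preimage_closed _ _ _ [set (1 : R)]) => //; exact: closed_eq.
have nrm v : v != 0 -> A ((Num.sqrt (bform 1%:M v v))^-1 *: v)^T.
  move=> /posdef1 v0; rewrite /A /= trmxK bform_scalel bform_scaler mulrA.
  by rewrite -invfM -expr2 sqr_sqrtr ?(ltW v0)// mulVf// gt_eqF.
have A0 : A !=set0.
  eexists; apply: (nrm (delta_mx 0 0)).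
  by apply/eqP => /matrixP/(_ 0 0); rewrite !mxE/= => /eqP; rewrite oner_eq0.
have [r /set_mem Ar rmin] := @compact_EVT_min _ R (fun r => bform S r^T r^T) A A0 cA
  (continuous_subspaceT (qc S)).
set mu := bform S r^T r^T in rmin *.
have ge v : mu * bform 1%:M v v <= bform S v v.
  have [->|v0] := eqVneq v 0.
    by rewrite -(scale0r 0) !bform_scalel !mul0r mulr0.
  have := rmin _ (mem_set (nrm _ v0)); rewrite trmxK bform_scalel bform_scaler mulrA.
  have v0' := posdef1 v0.
  rewrite -invfM -expr2 sqr_sqrtr ?(ltW v0')//.
  by rewrite mulrC ler_pdivlMr.
exists mu, r^T; split => //.
  apply/eqP => r0; move: Ar; rewrite /A/= r0 -(scale0r 0) bform_scalel mul0r.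
  by move=> /esym/eqP; rewrite oner_eq0.
apply/eqP; rewrite -subr_eq0; apply/eqP.
have -> : S *m r^T - mu *: r^T = (S - mu%:M) *m r^T.
  by rewrite mulmxBl mul_scalar_mx.
apply: semidef_isotropic_ker.
- by rewrite linearB /= sS tr_scalar_mx.
- by move=> v; rewrite bformDm bformNm bform_scalar subr_ge0.
- by rewrite bformDm bformNm bform_scalar Ar mulr1 subrr.
Qed.

Lemma posdef_coercive N (S : 'M[R]_N) : S^T = S -> posdef S ->
  exists2 k : R, 0 < k & forall v, k * bform 1%:M v v <= bform S v v.
Proof.
case: N S => [S _ _|N S sS pS].
  by exists 1 => // v; rewrite (flatmx0 v) /bform !mulmx0 mxE mulr0.
have [mu [u [u0 Su muP]]] := rayleigh_min sS.
exists mu => //; have := pS u u0.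
have -> : bform S u u = mu * bform 1%:M u u.
  by rewrite -{1}(mul1mx S) -bform_mulmxr Su bform_scaler.
by rewrite pmulr_lgt0 // posdef1.
Qed.

(** This is the lower bound of [rayleigh_min] applied to [- S]. *)
Lemma bform_bounded N (S : 'M[R]_N) : S^T = S ->
  exists2 C : R, 0 < C & forall v, bform S v v <= C * bform 1%:M v v.
Proof.
case: N S => [S _|N S sS].
  by exists 1 => // v; rewrite (flatmx0 v) /bform !mulmx0 mxE mulr0.
have [|mu [_ [_ _ muP]]] := @rayleigh_min _ (- S); first by rewrite linearN /= sS.
exists (1 + `|mu|); first by rewrite ltr_wpDr.
move=> v; have := muP v; rewrite bformNm.
have := bform1_ge0 v; set a := bform 1%:M v v => a0 H.
have : - mu * a <= (1 + `|mu|) * a.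
  rewrite ler_wpM2r// (le_trans (ler_norm _))// normrN; lra.
by lra.
Qed.

Lemma posdef_unitmx N (M : 'M[R]_N) : posdef M -> M \in unitmx.
Proof.
move=> pM; rewrite unitmxE unitfE; apply/negP => /det0P [r r0 rM].
have := pM r^T; rewrite /bform trmxK rM mul0mx mxE ltxx => H.
have : r^T != 0 by apply: contra_neq r0 => r0; rewrite -(trmxK r) r0 trmx0.
by move/H.
Qed.

(** An eigenvector [u] of the symmetric matrix [M^-1 K] with eigenvalue [mu]
    satisfies [K u = mu M u], so [mu] is the quotient of two positive numbers. *)
Lemma posdef_invmx_mul N (M K : 'M[R]_N) : M^T = M -> posdef M ->
  K^T = K -> posdef K -> comm_mx K (invmx M) -> posdef (invmx M *m K).
Proof.
case: N M K => [M K|N M K] sM pM sK pK cKM v v0.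
  by rewrite (flatmx0 v) eqxx in v0.
have sS : (invmx M *m K)^T = invmx M *m K.
  by rewrite trmx_mul trmx_inv sM sK cKM.
have [mu [u [u0 Su muP]]] := rayleigh_min sS.
suff mu0 : 0 < mu by rewrite (lt_le_trans _ (muP v))// mulr_gt0// posdef1.
have := pK u u0.
have Ku : K *m u = mu *: (M *m u).
  by rewrite scalemxAr -Su -mulmxA mulKVmx// posdef_unitmx.
have -> : bform K u u = mu * bform M u u.
  by rewrite -(mul1mx K) -bform_mulmxr Ku bform_scaler bform_mulmxr mul1mx.
by rewrite pmulr_lgt0 // pM.
Qed.

End BilinearForms.

(** * Linear flows and uniqueness of the forced field *)

Section LinearFlow.
Context {R : realType}.

Definition flow_coef N (A : 'M[R]_N) (x : 'cV[R]_N) (i : 'I_N) (k : nat) : R :=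
  iter k (mulmx A) x i 0 / k`!%:R.

(** This is [exp (t A) x], computed entry by entry as a real power series. *)
Definition linear_flow N (A : 'M[R]_N) (x : 'cV[R]_N) (t : R) : 'cV[R]_N :=
  \col_i limn (pseries (flow_coef A x i) t).

(** If [C] is the sum of the absolute values of the entries of [A], the entries of
    [A^k x] are at most [C^k D], so the series is dominated by that of
    [D exp (C |t|)]. *)
Lemma flow_coef_cvg N (A : 'M[R]_N) x i t : cvgn (pseries (flow_coef A x i) t).
Proof.
pose C : R := \sum_i \sum_j `|A i j|.
pose D : R := \sum_i `|x i 0|.
have D0 : 0 <= D by exact: sumr_ge0.
have C0 : 0 <= C by apply: sumr_ge0 => j _; exact: sumr_ge0.
have bnd k : forall i, `|iter k (mulmx A) x i 0| <= C ^+ k * D.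
  elim: k => [|k IH] {}i.
    by rewrite mul1r /= /D (bigD1 i)//= lerDl sumr_ge0.
  rewrite iterS mxE (le_trans (ler_norm_sum _ _ _))//.
  have -> : C ^+ k.+1 * D = C * (C ^+ k * D) by rewrite exprS mulrA.
  apply: (@le_trans _ _ ((\sum_j `|A i j|) * (C ^+ k * D))).
    by rewrite mulr_suml ler_sum// => j _; rewrite normrM ler_wpM2l.
  rewrite ler_wpM2r ?mulr_ge0 ?exprn_ge0// /C [leRHS](bigD1 i)//= lerDl.
  by apply: sumr_ge0 => j _; exact: sumr_ge0.
apply: normed_cvg.
apply: (@series_le_cvg _ _ (fun k => D * exp_coeff (C * `|t|) k)) => //.
- by move=> k; exact: normr_ge0.
- by move=> k; apply: mulr_ge0 => //; apply: exp_coeff_ge0; exact: mulr_ge0.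
- move=> k; rewrite /= /flow_coef /exp_coeff /= !normrM normrX normfV normr_nat.
  rewrite exprMn.
  have -> : D * (C ^+ k * `|t| ^+ k / k`!%:R) = C ^+ k * D / k`!%:R * `|t| ^+ k.
    by ring.
  by rewrite ler_wpM2r ?exprn_ge0// ler_wpM2r ?invr_ge0.
- exact: (@is_cvg_seriesZ _ _ D (is_cvg_series_exp_coeff (C * `|t|))).
Qed.

(** Formal differentiation amounts to replacing [x] by [A x]; every derived
    series is therefore again of the same form and convergent. *)
Lemma pseries_diffs_flow_coef N (A : 'M[R]_N) x i :
  pseries_diffs (flow_coef A x i) = flow_coef A (A *m x) i.
Proof.
apply/funext => k; rewrite /pseries_diffs /flow_coef -iterSr factS natrM.
by field; rewrite nat1r !pnatr_eq0 -lt0n fact_gt0.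
Qed.

Lemma linear_flow_mulmx N (A : 'M[R]_N) x t :
  linear_flow A (A *m x) t = A *m linear_flow A x t.
Proof.
apply/matrixP => i j; rewrite ord1 !mxE; apply: cvg_lim => //.
have -> : pseries (flow_coef A (A *m x) i) t =
    fun n => \sum_j A i j * pseries (flow_coef A x j) t n.
  apply/funext => n; rewrite /pseries /series /=.
  under [RHS]eq_bigr do rewrite mulr_sumr.
  rewrite exchange_big; apply: eq_bigr => k _.
  rewrite /flow_coef -iterSr iterS mxE !mulr_suml.
  by apply: eq_bigr => l _; ring.
apply: cvg_fin_sum => k; rewrite mxE; apply: cvgMl_tmp; exact: flow_coef_cvg.
Qed.

Lemma is_derive_linear_flow N (A : 'M[R]_N) x (t : R) :
  is_derive t (1 : R) (linear_flow A x) (A *m linear_flow A x t).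
Proof.
rewrite -linear_flow_mulmx; apply/is_derive_mxP => i j.
under eq_fun do rewrite mxE; rewrite mxE -pseries_diffs_flow_coef.
apply: (@pseries_snd_diffs _ _ (`|t| + 1)).
- exact: flow_coef_cvg.
- rewrite pseries_diffs_flow_coef; exact: flow_coef_cvg.
- rewrite !pseries_diffs_flow_coef; exact: flow_coef_cvg.
- by rewrite [ltRHS]ger0_norm ?addr_ge0// ltrDl.
Qed.

Lemma linear_flow0 N (A : 'M[R]_N) x : linear_flow A x 0 = x.
Proof.
apply/matrixP => i j; rewrite ord1 mxE.
apply: lim_near_cst => //; near=> n.
have n0 : (0 < n)%N by near: n; exists 1%N.
rewrite /pseries /series /= -(prednK n0) big_nat_recl//= big1 ?addr0.
  by rewrite /flow_coef /= expr0 divr1 mulr1.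
by move=> k _; rewrite expr0n mulr0.
Unshelve. all: by end_near. Qed.

Definition forced_mx n (M K : 'M[R]_n) (b : R) : 'M[R]_(n + n) :=
  block_mx 0 1%:M (- (invmx M *m K)) (- (b *: invmx M)).

Lemma forced_fieldE n (M K : 'M[R]_n) b x :
  forced_field M K b x = forced_mx M K b *m x.
Proof.
rewrite -{2}(vsubmxK x) mul_block_col mul0mx mul1mx add0r /forced_field.
by rewrite mulmxDr mulmxA -scalemxAr !mulNmx -scalemxAl opprD.
Qed.

(** The flow of [forced_mx] through [x] is an integral curve of the explicit field,
    hence a motion, hence an integral curve of [Gamma]; its velocity at time 0 is
    the value at [x] of both fields. *)
Lemma forced_mechanical_field_unique n (M K : 'M[R]_n) b Gamma :
  M^T = M -> K^T = K -> M \in unitmx ->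
  forced_mechanical_field (lagrangian M K) (dissipative_force b) Gamma ->
  Gamma = forced_field M K b.
Proof.
move=> sM sK uM [_ _ Gsol]; apply/funext => x.
have [_ _ Fsol] := forced_fieldP b sM sK uM.
pose c := linear_flow (forced_mx M K b) x.
have oT : open [set: R] by exact: openT.
have iT : is_interval [set: R] by [].
have cF : integral_curve (forced_field M K b) setT c.
  by move=> t _; rewrite forced_fieldE; exact: is_derive_linear_flow.
have cG : integral_curve Gamma setT c by apply/Gsol => //; apply/Fsol.
have [_ G0] := cG 0 I; have [_ F0] := cF 0 I.
by move: G0; rewrite F0 /c linear_flow0.
Qed.

End LinearFlow.

(** * The contraction estimate *)

Section Contraction.
Context {R : realType}.

Lemma smooth_cst (V W : normedModType R) (w : W) : smooth (cst w : V -> W).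
Proof.
move=> vs x.
suff [w' ->] : exists w', foldr (fun v (g : V -> W) => 'D_v g) (cst w) vs = cst w'.
  exact: differentiable_cst.
elim: vs => [|v vs [w' /= ->]]; first by exists w.
by exists 0; apply/funext => y; rewrite derive_cst.
Qed.

(** The coupling terms [u^T K w] produced by [K] and by [M M^-1 K = K] cancel; this is
    conservation of energy in the absence of friction. The off-diagonal blocks
    create the decay in [u] which friction alone does not give. *)
Lemma contraction_metric_dissipation n (M K : 'M[R]_n) b c u w :
  K^T = K -> M \in unitmx ->
  let G := block_mx K c%:M c%:M M in
  bform G (col_mx u w) (forced_field M K b (col_mx u w)) =
  - (c * bform (invmx M *m K) u u + c * b * bform (invmx M) u w
     + (b - c) * bform 1%:M w w).
Proof.
move=> sK uM G; rewrite /G /forced_field col_mxKu col_mxKd bform_block.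
rewrite mulmxDr mulmxA -scalemxAr.
rewrite !bform_oppr !bform_addr !bform_scaler !(bform_scalar c).
rewrite (bform_mulmxr M) mulKVmx// (bform_mulmxr M) mulmxV//.
rewrite !(bform_mulmxr 1%:M) !mul1mx (bform_sym w u sK).
ring.
Qed.

Lemma bform1_col_mx n (u w : 'cV[R]_n) :
  bform 1%:M (col_mx u w) (col_mx u w) = bform 1%:M u u + bform 1%:M w w.
Proof.
have z (x y : 'cV[R]_n) : bform 0 x y = 0 by rewrite /bform mulmx0 mul0mx mxE.
by rewrite (scalar_mx_block n n) bform_block !z !addr0.
Qed.

Lemma contraction_metric_sym n (M K : 'M[R]_n) (c : R) : M^T = M -> K^T = K ->
  (block_mx K c%:M c%:M M)^T = block_mx K c%:M c%:M M.
Proof. by move=> sM sK; rewrite tr_block_mx sM sK !tr_scalar_mx. Qed.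

(** By Young's inequality the coupling costs at most [c (|u|^2 + |w|^2)]. *)
Lemma contraction_metric_posdef n (M K : 'M[R]_n) (c k m : R) :
  0 < c -> c < k -> c < m ->
  (forall u, k * bform 1%:M u u <= bform K u u) ->
  (forall w, m * bform 1%:M w w <= bform M w w) ->
  posdef (block_mx K c%:M c%:M M).
Proof.
move=> c0 ck cm kP mP v v0; rewrite -(vsubmxK v).
have := posdef1 v0; rewrite -{1 2}(vsubmxK v) bform1_col_mx bform_block !(bform_scalar c).
move: (usubmx v) (dsubmx v) => u w nz.
rewrite (bform_sym w u (trmx1 _ _)).
have := young u w ltr01; rewrite invr1 !mul1r => Y.
have := kP u; have := mP w.
have := bform1_ge0 u; have := bform1_ge0 w.
move: Y nz; set a := bform 1%:M u u; set d := bform 1%:M w w.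
set p := bform 1%:M u w => Y nz d0 a0 Hm Hk.
have Yc : - (c * p + c * p) <= c * (a + d).
  by have := ler_wpM2l (ltW c0) Y; lra.
have [a_gt0|a_le0] := ltP 0 a.
  have : (k - c) * a > 0 by rewrite mulr_gt0// subr_gt0.
  have : (m - c) * d >= 0 by rewrite mulr_ge0// subr_ge0 ltW.
  by lra.
have : (k - c) * a >= 0 by rewrite mulr_ge0// subr_ge0 ltW.
have : (m - c) * d > 0 by rewrite mulr_gt0// ?subr_gt0//; lra.
by lra.
Qed.

(** With [kap] a coercivity constant of [M^-1 K] and
    [|M^-1 w|^2 <= p |w|^2], half of [c kap |u|^2] and [c b^2 p / (2 kap) |w|^2] dominate the mixed term.
    What is left of the friction is [b - c h] with [h = 1 + b^2 p / (2 kap)], and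
    [c] is chosen so that this is at least [b / 2] and the metric is positive. *)
Lemma forced_field_contracts n (M K : 'M[R]_n) (b : R) :
  M^T = M -> posdef M -> K^T = K -> posdef K -> comm_mx K (invmx M) -> 0 < b ->
  exists c : R, let G := block_mx K c%:M c%:M M in
    posdef G /\ exists2 l : R, 0 < l &
      forall v, bform G v (forced_field M K b v) <= - l * bform G v v.
Proof.
move=> sM pM sK pK cKM b0.
have uM := posdef_unitmx pM.
have [k k0 kP] := posdef_coercive sK pK.
have [m m0 mP] := posdef_coercive sM pM.
set P := invmx M; set S := P *m K.
have sS : S^T = S by rewrite /S trmx_mul trmx_inv sM sK cKM.
have [kap kap0 kapP] := posdef_coercive sS (posdef_invmx_mul sM pM sK pK cKM).
have [|p p0 pP] := @bform_bounded _ _ (P^T *m P); first by rewrite trmx_mul trmxK.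
pose h := 1 + b ^+ 2 * p / (2 * kap).
have h0 : 0 < h.
  by rewrite addr_gt0// divr_gt0 ?mulr_gt0 ?exprn_gt0.
pose c := Num.min (b / 2 / h) (Num.min k m / 2).
have c0 : 0 < c.
  by rewrite !lt_min !divr_gt0// lt_min k0.
have ckm : c <= Num.min k m / 2 by rewrite ge_min lexx orbT.
have minlt x : Num.min k m <= x -> 0 < x -> c < x.
  by move=> mx x0; move: ckm; lra.
have ck : c < k by apply: minlt => //; rewrite ge_min lexx.
have cm : c < m by apply: minlt => //; rewrite ge_min lexx orbT.
have ch : c * h <= b / 2 by rewrite -ler_pdivlMr// ge_min lexx.
exists c => G; split; first exact: contraction_metric_posdef kP mP.
have [C C0 CP] := bform_bounded (contraction_metric_sym c sM sK).
pose mu := Num.min (c * kap / 2) (b / 2).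
have mu0 : 0 < mu by rewrite lt_min !divr_gt0// mulr_gt0.
exists (mu / C); first by rewrite divr_gt0.
move=> v.
have decay : bform G v (forced_field M K b v) <= - mu * bform 1%:M v v.
  rewrite -(vsubmxK v); move: (usubmx v) (dsubmx v) => u w.
  rewrite contraction_metric_dissipation// bform1_col_mx.
  (* The weight kap spends exactly half of the decay in u on the mixed term. *)
  have := young u (b *: (P *m w)) kap0.
  rewrite !bform_scaler bform_scalel bform_mulmxr mul1mx.
  rewrite bform_mulmxr mul1mx bform_mulmxl.
  have := pP w; have := kapP u; rewrite -/P -/S.
  have := bform1_ge0 u; have := bform1_ge0 w.
  set a := bform 1%:M u u; set d := bform 1%:M w w.
  set s := bform S u u; set q := bform (_ *m _) w w; set x := bform P u w.
  move=> d0 a0 Hs Hq Hx.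
  have H1 : c * (kap * a) <= c * s by rewrite ler_wpM2l// ltW.
  have H2 : c * (- (2 * (b * x))) <= c * (kap * a + kap^-1 * (b * (b * (p * d)))).
    apply: ler_wpM2l (ltW c0) _ _ _; rewrite (le_trans Hx)// lerD2l.
    by rewrite !ler_wpM2l ?invr_ge0 ?(ltW b0) ?(ltW kap0).
  have H3 : c * h * d <= b / 2 * d by rewrite ler_wpM2r.
  have H4 : c * h * d = c * d + c * (kap^-1 * (b * (b * (p * d)))) / 2.
    by rewrite /h; field; rewrite gt_eqF.
  have H5 : mu * a <= c * kap / 2 * a by rewrite ler_wpM2r// ge_min lexx.
  have H6 : mu * d <= b / 2 * d by rewrite ler_wpM2r// ge_min lexx orbT.
  by lra.
apply: (le_trans decay); rewrite !mulNr lerN2 mulrAC ler_pdivrMr// -mulrA.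
by rewrite ler_pM2l// mulrC; exact: CP.
Qed.

End Contraction.

Theorem theorem3 (R : realType) (n : nat) (M K : 'M[R]_n) (b : R)
    (Gamma : 'cV[R]_(n + n) -> 'cV[R]_(n + n)) (qbar : 'cV[R]_n) :
  M^T = M -> posdef M ->
  K^T = K -> posdef K ->
  comm_mx K (invmx M) ->
  0 < b ->
  forced_mechanical_field (lagrangian M K) (dissipative_force b) Gamma ->
  isolated_zero (gradient (potential K)) qbar ->
  equilibrium (lagrangian M K) (dissipative_force b) qbar ->
  exists (U : set 'cV[R]_(n + n)) (eps : R),
    open_nbhs (col_mx qbar 0) U /\
    contracting_system Gamma (contraction_metric M K b eps) U.
Proof.
move=> sM pM sK pK cKM b0 field_Gamma _ _.
have uM := posdef_unitmx pM.
have GammaE := forced_mechanical_field_unique sM sK uM field_Gamma.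
have [smooth_Gamma _ _] := field_Gamma.
have [c [pG [l l0 decay]]] := forced_field_contracts sM pM sK pK cKM b0.
(* The off-diagonal entry of the metric is b * eps, to be equal to c. *)
exists setT, (c / b); split; first by split => //; exact: openT.
have metricE : contraction_metric M K b (c / b) = cst (block_mx K c%:M c%:M M).
  by apply/funext => x; rewrite /contraction_metric mulrCA divff ?gt_eqF// mulr1.
have sG := contraction_metric_sym c sM sK.
split => //; rewrite ?metricE.
- by split => //; exact: smooth_cst.
- exact: openT.
exists l => // x v _; rewrite /lie_derivative /=.
rewrite [X in X + _ + _](_ : _ = 0) ?add0r; last exact: derive_cst.
have -> : 'D_v Gamma x = forced_field M K b v.
  have lin : linear (forced_field M K b).
    by move=> a y z; rewrite !forced_fieldE mulmxDr -scalemxAr.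
  by rewrite GammaE; have [_ ->] := is_derive_linear x v lin.
rewrite (bform_sym _ v sG).
by have := decay v; lra.
Qed.
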